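(* Finite homogeneous effect algebras are covered by MV-algebras; that is, if $E$ is a finite homogeneous effect algebra, then $E$ is the union of its blocks and every block of $E$ is an MV-algebra.
   Context: An effect algebra is a partial algebra $(E;\oplus,0,1)$ with $0\neq 1$ and a partial binary operation $\oplus$ such that for all $x,y,z\in E$: (1) $x\oplus y=y\oplus x$ if $x\oplus y$ is defined; (2) $(x\oplus y)\oplus z=x\oplus(y\oplus z)$ if one side is defined; (3) for every $x$ there is a unique $y$ (denoted $x'$) with $x\oplus y=1$; (4) if $1\oplus x$ is defined then $x=0$. One writes $x\le y$ and $y\ominus x=z$ iff $x\oplus z$ is defined and equals $y$; $\le$ is a partial order. A sub-effect algebra of $E$ is a subset $Q\subseteq E$ with $1\in Q$ such that whenever $x\oplus y=z$ in $E$ and two of $x,y,z$ lie in $Q$, all three lie in $Q$; it is an effect algebra with the inherited operation. $E$ satisfies the Riesz decomposition property if $u\le v_1\oplus v_2$ implies $u=u_1\oplus u_2$ for some $u_1\le v_1$, $u_2\le v_2$. $E$ is homogeneous if $u\le v_1\oplus v_2\le u'$ implies $u=u_1\oplus u_2$ for some $u_1\le v_1$, $u_2\le v_2$. A block of a homogeneous effect algebra $E$ is a maximal sub-effect algebra of $E$ with the Riesz decomposition property. An effect algebra is said to be an MV-algebra (an MV-effect algebra) if it is lattice ordered and has the Riesz decomposition property; it is then an MV-algebra under the total operation $x\boxplus y=x\oplus(x'\wedge y)$ and negation $x\mapsto x'$. *)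

(* Defs.v *)
From HB Require Import structures.
From mathcomp Require Import all_boot.

Set Implicit Arguments.
Unset Strict Implicit.
Unset Printing Implicit Defensive.

(* [oplus x y = None] means that the partial sum of x and y is undefined; as
   equations between options, [oplusC] and [oplusA] say that one side is
   defined iff the other is, and that the two values then agree. *)
HB.mixin Record isEffectAlgebra (E : Type) := {
  ea0 : E;
  ea1 : E;
  oplus : E -> E -> option E;
  ocompl : E -> E;
  ea0_neq1 : ea0 <> ea1;
  oplusC : forall x y, oplus x y = oplus y x;
  oplusA : forall x y z,
    obind (fun s => oplus s z) (oplus x y) = obind (oplus x) (oplus y z);
  oplus_ocompl : forall x y, oplus x y = Some ea1 <-> y = ocompl x;
  oplus1 : forall x, oplus ea1 x <> None -> x = ea0
}.

#[short(type="effectAlgebraType")]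
HB.structure Definition EffectAlgebra := {E of isEffectAlgebra E}.

#[short(type="finEffectAlgebraType")]
HB.structure Definition FinEffectAlgebra := {E of isEffectAlgebra E & Finite E}.

Section Properties.
Variable E : effectAlgebraType.
Implicit Types x y z u v : E.

Definition ea_le x y : Prop := exists z, oplus x z = Some y.

Definition is_meet x y m : Prop :=
  [/\ ea_le m x, ea_le m y
    & forall z, ea_le z x -> ea_le z y -> ea_le z m].

Definition is_join x y j : Prop :=
  [/\ ea_le x j, ea_le y j
    & forall z, ea_le x z -> ea_le y z -> ea_le j z].

Definition splits_below u v1 v2 : Prop :=
  exists u1 u2, [/\ ea_le u1 v1, ea_le u2 v2 & oplus u1 u2 = Some u].

End Properties.

Definition lattice_ordered (E : effectAlgebraType) : Prop :=
  forall x y : E, (exists m, is_meet x y m) /\ (exists j, is_join x y j).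

Definition riesz_decomposition (E : effectAlgebraType) : Prop :=
  forall u v1 v2 v : E,
    oplus v1 v2 = Some v -> ea_le u v -> splits_below u v1 v2.

Definition homogeneous (E : effectAlgebraType) : Prop :=
  forall u v1 v2 v : E,
    oplus v1 v2 = Some v -> ea_le u v -> ea_le v (ocompl u) ->
    splits_below u v1 v2.

Definition mv_effect_algebra (E : effectAlgebraType) : Prop :=
  lattice_ordered E /\ riesz_decomposition E.

Definition sub_effect_closed (E : finEffectAlgebraType) (Q : {set E}) : Prop :=
  ea1 \in Q /\
  forall x y z : E, oplus x y = Some z ->
    (x \in Q /\ y \in Q) \/ (x \in Q /\ z \in Q) \/ (y \in Q /\ z \in Q) ->
    [/\ x \in Q, y \in Q & z \in Q].

Record subEA (E : finEffectAlgebraType) := SubEA {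
  subea_set :> {set E};
  subeaP : sub_effect_closed subea_set
}.

Definition subea_type (E : finEffectAlgebraType) (Q : subEA E) : Type :=
  {x : E | x \in subea_set Q}.

Section SubEffectAlgebra.
Variables (E : finEffectAlgebraType) (Q : subEA E).
Local Notation S := (subea_type Q).
Implicit Types x y z : S.

Lemma ocompl1 : ocompl ea1 = ea0 :> E.
Proof.
have h : oplus ea1 (ocompl ea1) = Some (ea1 : E) by apply/oplus_ocompl.
by apply: oplus1; rewrite h.
Qed.

Lemma subea1_in : (ea1 : E) \in subea_set Q. Proof. by case: (subeaP Q). Qed.

Lemma subea_compl_in (x : E) :
  x \in subea_set Q -> ocompl x \in subea_set Q.
Proof.
move=> xQ; case: (subeaP Q) => Q1 Qc.
have h : oplus x (ocompl x) = Some (ea1 : E) by apply/oplus_ocompl.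
by case: (Qc _ _ _ h); first by right; left.
Qed.

Lemma subea0_in : (ea0 : E) \in subea_set Q.
Proof. by rewrite -ocompl1 subea_compl_in // subea1_in. Qed.

Lemma subea_oplus_in (x y z : E) :
  x \in subea_set Q -> y \in subea_set Q -> oplus x y = Some z ->
  z \in subea_set Q.
Proof.
by move=> xQ yQ h; case: (subeaP Q) => _ Qc; case: (Qc _ _ _ h); first by left.
Qed.

Definition subea0 : S := exist _ ea0 subea0_in.
Definition subea1 : S := exist _ ea1 subea1_in.
Definition subea_ocompl x : S :=
  exist _ (ocompl (val x)) (subea_compl_in (valP x)).

(* [insub] never fails here, since the sum of two elements of Q, when it is
   defined in E, lies in Q; see [subea_oplusE]. *)
Definition subea_oplus x y : option S := obind insub (oplus (val x) (val y)).

Lemma subea_oplusE x y :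
  omap val (subea_oplus x y) = oplus (val x) (val y).
Proof.
rewrite /subea_oplus; case h: (oplus _ _) => [z|] //=.
by rewrite insubT //; apply: subea_oplus_in h; apply: valP.
Qed.

Lemma omap_val_inj : injective (omap (val : S -> E)).
Proof. by move=> [x|] [y|] //= [/val_inj ->]. Qed.

Lemma subea_neq01 : subea0 <> subea1.
Proof. by move/(congr1 val); apply: ea0_neq1. Qed.

Lemma subea_oplusC x y : subea_oplus x y = subea_oplus y x.
Proof. by apply: omap_val_inj; rewrite !subea_oplusE oplusC. Qed.

Lemma subea_oplusA x y z :
  obind (fun s => subea_oplus s z) (subea_oplus x y)
    = obind (subea_oplus x) (subea_oplus y z).
Proof.
apply: omap_val_inj; have := oplusA (val x) (val y) (val z).
rewrite -!subea_oplusE.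
by case: (subea_oplus x y) (subea_oplus y z) => [s|] [t|] //=;
  rewrite ?subea_oplusE.
Qed.

Lemma subea_oplus_ocompl x y :
  subea_oplus x y = Some subea1 <-> y = subea_ocompl x.
Proof.
split=> [/(congr1 (omap val))|->].
  by rewrite subea_oplusE => /oplus_ocompl h; apply: val_inj.
by apply: omap_val_inj; rewrite subea_oplusE; apply/oplus_ocompl.
Qed.

Lemma subea_oplus1 x : subea_oplus subea1 x <> None -> x = subea0.
Proof.
move=> h; apply: val_inj; apply: oplus1 => /= h1; apply: h.
by apply: omap_val_inj; rewrite subea_oplusE.
Qed.

HB.instance Definition _ := isEffectAlgebra.Build S
  subea_neq01 subea_oplusC subea_oplusA subea_oplus_ocompl subea_oplus1.

End SubEffectAlgebra.

Definition block (E : finEffectAlgebraType) (B : subEA E) : Prop :=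
  riesz_decomposition (subea_type B) /\
  forall C : subEA E, riesz_decomposition (subea_type C) ->
    B \subset C -> C = B :> {set E}.

(* Main.v *)
From HB Require Import structures.
Require Import Defs.
From mathcomp Require Import all_boot.
From Stdlib Require Import Classical.

Set Implicit Arguments.
Unset Strict Implicit.
Unset Printing Implicit Defensive.

(* Write 1 as the sum of a family S of atoms refining x + x'.  By homogeneity,
   an atom a with a <= sum T <= a', where T consists of atoms, occurs in T.
   Hence the multiplicity in S of an atom of S is the largest n such that n
   copies of it are summable, so every summable family of elements of S is a
   submultiset of S.  The sums of such families therefore form a sub-effect
   algebra isomorphic to a product of finite chains; it has the Riesz
   decomposition property and extends to a block by finiteness.  Conversely the
   Riesz decomposition property implies the interpolation property, which for a
   finite poset with bounds gives all meets and joins. *)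

(** * Finite multisets, as sequences up to permutation *)

Lemma perm_count_nseq (T : eqType) (s : seq T) a n : n <= count_mem a s ->
  exists2 t, perm_eq s (nseq n a ++ t) & count_mem a t = count_mem a s - n.
Proof.
move=> le_n.
have [r sub_r] : exists2 r, subseq r s & perm_eq (nseq n a) r.
  apply/count_subseqP => b; rewrite count_nseq /=.
  by have [<-|] := eqVneq a b; rewrite ?mul1n ?mul0n.
move=> perm_r; have [t ht] := perm_to_subseq sub_r.
have st : perm_eq s (nseq n a ++ t).
  by apply: perm_trans ht _; rewrite perm_cat2r perm_sym.
exists t => //; move/permP: st => ->.
by rewrite count_cat count_nseq /= eqxx mul1n addKn.
Qed.

(** Riesz decomposition for multisets: [s] is a permutation of some masked subsequence of
    [s1 ++ s2], and the mask is cut at [size s1]. *)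
Lemma perm_cat_split (T : eqType) (s t s1 s2 : seq T) :
  perm_eq (s ++ t) (s1 ++ s2) ->
  exists r1 r2, [/\ perm_eq s (r1 ++ r2), subseq r1 s1 & subseq r2 s2].
Proof.
move=> h.
have [r /subseqP[m sz_m ->] sr] : exists2 r, subseq r (s1 ++ s2) & perm_eq s r.
  apply/count_subseqP => a; move/permP: h => /(_ (pred1 a)) <-.
  by rewrite count_cat leq_addr.
move: sr; rewrite -{1}(cat_take_drop (size s1) m) mask_cat; last first.
  by rewrite size_takel // sz_m size_cat leq_addr.
move=> sr; exists (mask (take (size s1) m) s1), (mask (drop (size s1) m) s2).
by split=> //; apply: mask_subseq.
Qed.

(** * Partial addition, cancellation, order and interpolation *)

Section EffectAlgebraTheory.
Variable E : effectAlgebraType.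
Implicit Types (x y z u v w : E) (o : option E) (s t : seq E).

(** With [None] absorbing, the partial sum becomes a total commutative monoid law, so that monoid
    lemmas and big operators apply to it. *)
Definition oadd o1 o2 : option E := obind (fun x => obind (oplus x) o2) o1.

Lemma ocompl_ea1 : ocompl (ea1 : E) = ea0.
Proof.
have h : oplus (ea1 : E) (ocompl ea1) = Some ea1 by apply/oplus_ocompl.
by apply: oplus1; rewrite h.
Qed.

Lemma ocomplK : involutive (@ocompl E).
Proof.
by move=> x; apply/esym/oplus_ocompl; rewrite oplusC; apply/oplus_ocompl.
Qed.

Lemma oplusx0 x : oplus x ea0 = Some x.
Proof.
have h1 : oplus (ea1 : E) ea0 = Some ea1.
  by apply/oplus_ocompl; rewrite ocompl_ea1.
have hx : oplus (ocompl x) x = Some ea1 by rewrite oplusC; apply/oplus_ocompl.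
have := oplusA (ocompl x) x ea0; rewrite hx /= h1.
case: (oplus x ea0) => //= w /esym/oplus_ocompl ->.
by rewrite ocomplK.
Qed.

Lemma oaddC : commutative oadd.
Proof. by move=> [x|] [y|] //=; apply: oplusC. Qed.

Lemma oaddA : associative oadd.
Proof.
move=> [x|] [y|] [z|] //=; first by rewrite /oadd /= -oplusA.
by rewrite /oadd /=; case: (oplus x y).
Qed.

Lemma oadd0o : left_id (Some ea0) oadd.
Proof. by move=> [x|] //=; rewrite /oadd /= oplusC oplusx0. Qed.

HB.instance Definition _ :=
  Monoid.isComLaw.Build (option E) (Some ea0) oadd oaddA oaddC oadd0o.

Lemma oaddCA : left_commutative oadd.
Proof. exact: Monoid.mulmCA. Qed.

Lemma oaddACA : interchange oadd oadd.
Proof. exact: Monoid.mulmACA. Qed.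

Lemma oadd_someP o1 o2 w :
  oadd o1 o2 = Some w -> exists x y, o1 = Some x /\ o2 = Some y.
Proof. by case: o1 o2 => [x|] [y|] //= _; exists x, y. Qed.

Lemma ea_le_oadd x o y : oadd (Some x) o = Some y -> ea_le x y.
Proof. by case: o => // z; exists z. Qed.

Lemma oadd_ocompl x o : oadd (Some x) o = Some ea1 -> o = Some (ocompl x).
Proof. by case: o => // z /oplus_ocompl ->. Qed.

Lemma ocompl_oadd x : oadd (Some x) (Some (ocompl x)) = Some ea1.
Proof. exact/oplus_ocompl. Qed.

(** From x + y + w' = 1 one gets y = (x + w')', so y is determined by x and w. *)
Lemma oplusI x y z w : oplus x y = Some w -> oplus x z = Some w -> y = z.
Proof.
have key v : oplus x v = Some w ->
    Some v = omap (@ocompl E) (oadd (Some x) (Some (ocompl w))).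
  rewrite -[oplus x v]/(oadd (Some x) (Some v)) => h.
  have := ocompl_oadd w; rewrite -{1}h (oaddC (Some x)) -oaddA oaddC.
  case: (oadd (Some x) _) => // t /oadd_ocompl [->] //.
by move=> /key hy /key hz; move: hz; rewrite -hy => -[].
Qed.

Lemma oaddI x o1 o2 w :
  oadd (Some x) o1 = Some w -> oadd (Some x) o2 = Some w -> o1 = o2.
Proof. by case: o1 o2 => [y|] [z|] // hy hz; rewrite (oplusI hy hz). Qed.

(** Since 1 + (x + y) = 1 + 0 is defined, so is 1 + x, which forces x = 0. *)
Lemma oplus_eq0 x y : oplus x y = Some ea0 -> x = ea0.
Proof.
move=> h; apply: oplus1.
have := oplusx0 ea1; rewrite -[oplus _ _]/(oadd (Some ea1) (Some ea0)) -h.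
rewrite -[oplus x y]/(oadd (Some x) (Some y)) oaddA.
by case/oadd_someP=> [t] [_ [+ _]] => /= ->.
Qed.

Lemma ea_le_refl x : ea_le x x.
Proof. by exists ea0; apply: oplusx0. Qed.

Lemma ea_le0 x : ea_le ea0 x.
Proof. by exists x; rewrite oplusC oplusx0. Qed.

Lemma ea_le1 x : ea_le x ea1.
Proof. exact: ea_le_oadd (ocompl_oadd x). Qed.

Lemma ea_le_trans y x z : ea_le x y -> ea_le y z -> ea_le x z.
Proof.
case=> u hu [v hv]; apply: (@ea_le_oadd _ (oadd (Some u) (Some v))).
by rewrite oaddA [oadd (Some x) (Some u)]hu.
Qed.

Lemma riesz_interpolation :
  riesz_decomposition E -> forall a1 a2 b1 b2 : E,
  ea_le a1 b1 -> ea_le a1 b2 -> ea_le a2 b1 -> ea_le a2 b2 ->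
  exists c, [/\ ea_le a1 c, ea_le a2 c, ea_le c b1 & ea_le c b2].
Proof.
move=> rdp a1 a2 b1 b2 [c11 h11] [c12 h12] [c21 h21] [c22 h22].
(* Splitting a1 below a2 + c21 = b1 gives the refinement a1 = p + q, a2 = p + r, c21 = q + s. *)
have [p [q [[r hr] [s hs] hpq]]] := rdp a1 a2 c21 b1 h21 (ex_intro _ _ h11).
have a1E : Some a1 = oadd (Some p) (Some q) by [].
have a2E : Some a2 = oadd (Some p) (Some r) by [].
have c21E : Some c21 = oadd (Some q) (Some s) by [].
have c11E : Some c11 = oadd (Some r) (Some s).
  apply: (@oaddI a1 _ _ b1) => //.
  by rewrite a1E oaddACA -a2E -c21E.
(* Cancelling p in a1 + c12 = b2 = a2 + c22 gives q + c12 = r + c22, so r can be split along q and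
   c12. *)
have [w hw1 hw2] : exists2 w, oadd (Some q) (Some c12) = Some w
                            & oadd (Some r) (Some c22) = Some w.
  have e1 : oadd (Some p) (oadd (Some q) (Some c12)) = Some b2.
    by rewrite oaddA -a1E.
  have e2 : oadd (Some p) (oadd (Some r) (Some c22)) = Some b2.
    by rewrite oaddA -a2E.
  have [_ [w [_ hw]]] := oadd_someP e1.
  by exists w => //; rewrite -(oaddI e1 e2).
have [r1 [r2 [[q' hq'] [k hk] hr12]]] := rdp r q c12 w hw1 (ea_le_oadd hw2).
have rE : Some r = oadd (Some r1) (Some r2) by [].
have qE : Some q = oadd (Some r1) (Some q') by [].
have c12E : Some c12 = oadd (Some r2) (Some k) by [].
have hb2 : oadd (oadd (Some a1) (Some r2)) (Some k) = Some b2.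
  by rewrite -oaddA -c12E.
have [c [_ [hc _]]] := oadd_someP hb2.
(* The interpolant is c = a1 + r2: the part r1 of r already lies in q. Thus c = a2 + q', b1 = c + r1
   + s and b2 = c + k. *)
exists c; split.
- exact: ea_le_oadd hc.
- apply: (@ea_le_oadd _ (Some q')).
  rewrite -hc a1E a2E qE rE -!oaddA; congr (oadd _ (oadd _ _)).
  exact: oaddC.
- apply: (@ea_le_oadd _ (oadd (Some r1) (Some s))).
  by rewrite -hc -oaddA (oaddCA (Some r2)) (oaddA (Some r1)) -rE -c11E.
- by apply: (@ea_le_oadd _ (Some k)); rewrite -hc.
Qed.

Definition osum s : option E := \big[oadd/Some ea0]_(x <- s) Some x.

Lemma osum_nil : osum [::] = Some ea0.
Proof. exact: big_nil. Qed.

Lemma osum_cons x s : osum (x :: s) = oadd (Some x) (osum s).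
Proof. exact: big_cons. Qed.

Lemma osum_cat s t : osum (s ++ t) = oadd (osum s) (osum t).
Proof. exact: big_cat. Qed.

Lemma osum_seq1 x : osum [:: x] = Some x.
Proof. exact: big_seq1. Qed.

End EffectAlgebraTheory.

(** * Finite effect algebras: lattice order, atoms, sums of atoms *)

Section FiniteEffectAlgebra.
Variable E : finEffectAlgebraType.
Implicit Types (x y z u v w a b : E) (s t S : seq E).

Definition ea_leb x y := [exists z, oplus x z == Some y].

Lemma ea_leP x y : reflect (ea_le x y) (ea_leb x y).
Proof. exact: 'exists_eqP. Qed.

(** Its cardinality serves as a strictly monotone rank, both for choosing extremal bounds and for
    induction. *)
Definition downset x : {set E} := [set z | ea_leb z x].

Lemma ea_le_downset x y : ea_le x y -> downset x \subset downset y.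
Proof.
move=> xy; apply/subsetP=> z; rewrite !inE => /ea_leP zx.
by apply/ea_leP; apply: ea_le_trans xy.
Qed.

Lemma ea_le_card_downset x y :
  ea_le x y -> #|downset y| <= #|downset x| -> ea_le y x.
Proof.
move=> xy le_yx.
have /eqP e : downset x == downset y by rewrite eqEcard ea_le_downset.
have : y \in downset x by rewrite e inE; apply/ea_leP/ea_le_refl.
by rewrite inE => /ea_leP.
Qed.

Lemma riesz_lattice : riesz_decomposition E -> lattice_ordered E.
Proof.
move=> rdp x y; split.
  pose P := [pred m | ea_leb m x && ea_leb m y].
  have P0 : P ea0 by apply/andP; split; apply/ea_leP/ea_le0.
  case: (arg_maxnP (fun m => #|downset m|) P0) => m.
  case/andP=> /ea_leP mx /ea_leP my max_m.
  exists m; split=> // z zx zy.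
  (* The interpolant c is a common lower bound above m, and its down-set is no larger than that of
     m, so c ≤ m and hence z ≤ m. Joins are dual. *)
  have [c [mc zc cx cy]] := riesz_interpolation rdp mx my zx zy.
  apply: ea_le_trans zc _; apply: ea_le_card_downset mc _.
  by apply: max_m; apply/andP; split; apply/ea_leP.
pose P := [pred j | ea_leb x j && ea_leb y j].
have P1 : P ea1 by apply/andP; split; apply/ea_leP/ea_le1.
case: (arg_minnP (fun j => #|downset j|) P1) => j.
case/andP=> /ea_leP xj /ea_leP yj min_j.
exists j; split=> // z xz yz.
have [c [xc yc cj cz]] := riesz_interpolation rdp xj xz yj yz.
apply: ea_le_trans cz; apply: ea_le_card_downset cj _.
by apply: min_j; apply/andP; split; apply/ea_leP.
Qed.

Definition atom a :=
  (a != ea0) &&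
  [forall u, forall v,
    (oplus u v == Some a) ==> (u == ea0) || (v == ea0)].

Lemma atomP a : atom a ->
  a <> ea0 /\ forall u v, oplus u v = Some a -> u = ea0 \/ v = ea0.
Proof.
case/andP=> /eqP a0 /forallP h; split=> // u v /eqP huv.
by have /forallP/(_ v)/implyP/(_ huv)/orP[] := h u => /eqP; [left | right].
Qed.

(** Otherwise z ≤ x, so x + y + t = x for some t; cancelling x leaves y + t = 0 and y = 0. *)
Lemma ltn_card_downset x y z :
  oplus x y = Some z -> y <> ea0 -> #|downset x| < #|downset z|.
Proof.
move=> hxy y0; rewrite ltnNge; apply/negP=> le_zx; apply: y0.
have [t ht] := ea_le_card_downset (ex_intro _ _ hxy) le_zx.
have : oadd (Some x) (oadd (Some y) (Some t)) = Some x.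
  by rewrite oaddA [oadd (Some x) (Some y)]hxy.
by move/(@oaddI _ x _ (Some ea0))/(_ (oplusx0 x)); apply: oplus_eq0.
Qed.

(** A nonzero non-atom is a sum of two nonzero elements, each with a strictly smaller down-set. *)
Lemma atomic_decomposition x : exists2 s, all atom s & osum s = Some x.
Proof.
have [n] := ubnP #|downset x|; elim: n x => // n IH x lt_xn.
have [->|x0] := eqVneq x ea0; first by exists [::] => //; apply: osum_nil.
have [ax|] := boolP (atom x).
  by exists [:: x]; [rewrite /= ax | apply: osum_seq1].
rewrite /atom x0 /= negb_forall => /existsP[u].
rewrite negb_forall => /existsP[v].
rewrite negb_imply negb_or => /andP[/eqP huv /andP[/eqP u0 /eqP v0]].
have hvu : oplus v u = Some x by rewrite oplusC.
have lt_ux := leq_trans (ltn_card_downset huv v0) lt_xn.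
have lt_vx := leq_trans (ltn_card_downset hvu u0) lt_xn.
have [s as_ hs] := IH u lt_ux; have [t at_ ht] := IH v lt_vx.
exists (s ++ t); first by rewrite all_cat as_.
by rewrite osum_cat hs ht.
Qed.

Lemma perm_osum s t : perm_eq s t -> osum s = osum t.
Proof. exact: perm_big. Qed.

Lemma osum_atom_eq0 s : all atom s -> osum s = Some ea0 -> s = [::].
Proof.
case: s => // a s /andP[/atomP[a0 _] _].
by rewrite osum_cons; case: (osum s) => // v /oplus_eq0.
Qed.

Lemma val_oplus (Q : subEA E) (x y : subea_type Q) :
  omap val (oplus x y) = oplus (val x) (val y).
Proof. exact: subea_oplusE. Qed.

(** The order is inherited because a difference of two members of [Q] lies in [Q]. *)
Lemma subea_le (Q : subEA E) (x y : subea_type Q) :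
  ea_le x y <-> ea_le (val x) (val y).
Proof.
split=> [[z hz]|[z hz]]; first by exists (val z); rewrite -val_oplus hz.
have zQ : z \in subea_set Q.
  have [_ /(_ _ _ _ hz)[]//] := subeaP Q.
  by right; left; split; apply: valP.
exists (exist _ z zQ); apply: omap_val_inj.
by rewrite val_oplus.
Qed.

(** * Consequences of homogeneity *)

Hypothesis hE : homogeneous E.

(** Induction on the family b :: t, with w the sum of t: homogeneity splits a along b + w, and since
    a is an atom, a ≤ b or a ≤ w. In the first case a = b because b is an atom; in the second, w ≤ v
    ≤ a' allows the induction to go on. *)
Lemma atom_mem_osum a t v :
  atom a -> all atom t -> osum t = Some v -> ea_le a v ->
  ea_le v (ocompl a) -> a \in t.
Proof.
move=> /atomP[a0 a_at]; elim: t v => [|b t IH] v.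
  by move=> _; rewrite osum_nil => -[<-] [z /oplus_eq0].
case/andP=> /atomP[_ b_at] at_; rewrite osum_cons.
case ht: (osum t) => [w|] // hbw av va'.
have [u1 [u2 [[z hz] u2w hu]]] := hE hbw av va'; rewrite inE.
case: (a_at _ _ hu) => u0; last first.
  have u1a : u1 = a by move: hu; rewrite u0 oplusx0 => -[].
  case: (b_at _ _ hz) => [u10|z0]; first by case: a0; rewrite -u1a.
  by move: hz; rewrite z0 oplusx0 u1a => -[->]; rewrite eqxx.
have u2a : u2 = a by move: hu; rewrite u0 oplusC oplusx0 => -[].
rewrite (IH w) ?orbT // -?u2a //.
rewrite u2a; apply: ea_le_trans va'; apply: (@ea_le_oadd _ _ (Some b)).
by rewrite oaddC.
Qed.

(** * The sub-effect algebra of sums from a family of atoms with sum 1 *)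

Section AtomFamily.
Variable S : seq E.
Hypothesis (atS : all atom S) (S1 : osum S = Some ea1).

(** Let a occur n > 0 times in [S], let p be the sum of these copies and T the other members of [S],
    with sum p'. If [s] had n + 1 copies, a + p would be defined, so a ≤ p'; also p' ≤ a' because a
    ≤ p. Then a would occur in T by [atom_mem_osum], though no copy is left there. *)
Lemma summable_count s x a : {subset s <= S} -> osum s = Some x ->
  count_mem a s <= count_mem a S.
Proof.
move=> sS hx; rewrite leqNgt; apply/negP=> lt_a.
have aS : a \in S.
  by apply: sS; rewrite -has_pred1 has_count (leq_ltn_trans _ lt_a).
have [t ht _] := perm_count_nseq lt_a.
have [T hT cT] := perm_count_nseq (leqnn (count_mem a S)).
set n := count_mem a S in lt_a ht hT cT.
have n0 : 0 < n by rewrite -has_count has_pred1.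
have := S1; rewrite (perm_osum hT) osum_cat => hS.
have [p [v [hp hv]]] := oadd_someP hS.
have ev : v = ocompl p by move: hS; rewrite hp hv => /oadd_ocompl[].
have atT : all atom T by move: atS; rewrite (perm_all _ hT) all_cat => /andP[].
have a_at : atom a by move/allP: atS; apply.
suff : a \in T by rewrite -has_pred1 has_count cT subnn.
apply: (@atom_mem_osum a T v) => //.
  have := hx; rewrite (perm_osum ht) osum_cat osum_cons hp.
  case/oadd_someP=> [y [_ [hy _]]].
  apply: (@ea_le_oadd _ _ (Some (ocompl y))).
  suff -> : Some v = oadd (Some a) (Some (ocompl y)) by [].
  rewrite ev; apply/esym/oadd_ocompl.
  by rewrite oaddA (oaddC (Some p)) hy; apply: ocompl_oadd.
move: hS; rewrite hv -(prednK n0) /= osum_cons -oaddA => /oadd_ocompl.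
by rewrite oaddC => h; apply: ea_le_oadd h.
Qed.

Lemma summable_perm s x : {subset s <= S} -> osum s = Some x ->
  exists2 t, perm_eq S (s ++ t) & osum t = Some (ocompl x).
Proof.
move=> sS hx.
have [r /perm_to_subseq[t ht] sr] : exists2 r, subseq r S & perm_eq s r.
  by apply/count_subseqP => a; apply: summable_count hx.
have hst : perm_eq S (s ++ t).
  by apply: perm_trans ht _; rewrite perm_cat2r perm_sym.
exists t => //; apply: oadd_ocompl.
by rewrite -hx -osum_cat -(perm_osum hst).
Qed.

(** If r completes [s] to [S], then [t ++ r] also sums to 1. Its own completion to [S] is a family
    of atoms with sum 0, hence empty, and r cancels from both permutations of [S]. *)
Lemma osum_inj s t x : {subset s <= S} -> {subset t <= S} ->
  osum s = Some x -> osum t = Some x -> perm_eq s t.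
Proof.
move=> sS tS hs ht.
have [r hr ex] := summable_perm sS hs.
have rS : {subset r <= S}.
  by move=> y yr; rewrite (perm_mem hr) mem_cat yr orbT.
have trS : {subset t ++ r <= S}.
  by move=> y; rewrite mem_cat => /orP[/tS|/rS].
have htr : osum (t ++ r) = Some ea1.
  by rewrite osum_cat ht ex; apply: ocompl_oadd.
have [q hq] := summable_perm trS htr; rewrite ocompl_ea1 => q0.
have atq : all atom q by move: atS; rewrite (perm_all _ hq) all_cat => /andP[].
move: hq; rewrite (osum_atom_eq0 atq q0) cats0 => hq.
by rewrite -(perm_cat2r r); apply: perm_trans hq; rewrite perm_sym.
Qed.

(** Masks of [S] keep the search finite; nothing is lost, since a summable family of members of [S]
    is a submultiset of [S]. *)
Definition sums_of : {set E} :=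
  [set x | [exists m : (size S).-tuple bool, osum (mask m S) == Some x]].

Lemma sums_ofP x :
  reflect (exists2 s, {subset s <= S} & osum s = Some x) (x \in sums_of).
Proof.
rewrite inE; apply: (iffP 'exists_eqP) => [[m hm]|[s sS hs]].
  by exists (mask m S) => // y; apply: mem_mask.
have [r /subseqP[m sz_m r_m] sr] : exists2 r, subseq r S & perm_eq s r.
  by apply/count_subseqP => a; apply: summable_count hs.
move/eqP: sz_m => sz_m; exists (Tuple sz_m).
by rewrite /= -r_m -(perm_osum sr).
Qed.

(** Concatenated families give sums, and the rest of [S] gives complements; differences reduce to
    these two. *)
Lemma sums_of_closed : sub_effect_closed sums_of.
Proof.
have Qcompl x : x \in sums_of -> ocompl x \in sums_of.
  case/sums_ofP=> s sS hs; have [t ht hx] := summable_perm sS hs.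
  apply/sums_ofP; exists t => // y yt.
  by rewrite (perm_mem ht) mem_cat yt orbT.
have Qadd x y z :
    oplus x y = Some z -> x \in sums_of -> y \in sums_of -> z \in sums_of.
  move=> hxy /sums_ofP[s sS hs] /sums_ofP[t tS ht].
  apply/sums_ofP; exists (s ++ t).
    by move=> v; rewrite mem_cat => /orP[/sS|/tS].
  by rewrite osum_cat hs ht.
(* x + y = z iff x + z' = y' *)
have Qsub x y z :
    oplus x y = Some z -> x \in sums_of -> z \in sums_of -> y \in sums_of.
  move=> hxy xQ /Qcompl zQ; rewrite -(ocomplK y); apply: Qcompl.
  apply: (Qadd x (ocompl z)) => //; apply: oadd_ocompl.
  rewrite -[oplus _ _]/(oadd (Some x) (Some (ocompl z))) oaddCA oaddA.
  by rewrite [oadd (Some x) (Some y)]hxy; apply: ocompl_oadd.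
split; first by apply/sums_ofP; exists S.
move=> x y z hxy; have hyx : oplus y x = Some z by rewrite oplusC.
case=> [[xQ yQ]|[[xQ zQ]|[yQ zQ]]]; split=> //.
- exact: Qadd hxy _ _.
- exact: Qsub hxy _ _.
- exact: Qsub hyx _ _.
Qed.

Definition sums_of_subEA : subEA E := SubEA sums_of_closed.

(** By [osum_inj], the equation u + w = v1 + v2 lifts to a permutation of multisets of atoms, where
    [perm_cat_split] decomposes u. *)
Lemma sums_of_riesz : riesz_decomposition (subea_type sums_of_subEA).
Proof.
move=> u v1 v2 v hv [w hw].
move/(congr1 (omap val)): hv; rewrite val_oplus /= => hv.
move/(congr1 (omap val)): hw; rewrite val_oplus /= => hw.
have /sums_ofP[s sS hs] := valP u; have /sums_ofP[t tS ht] := valP w.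
have /sums_ofP[s1 s1S hs1] := valP v1; have /sums_ofP[s2 s2S hs2] := valP v2.
have catS p q : {subset p <= S} -> {subset q <= S} -> {subset p ++ q <= S}.
  by move=> pS qS y; rewrite mem_cat => /orP[/pS|/qS].
have hst : osum (s ++ t) = Some (val v) by rewrite osum_cat hs ht.
have hs12 : osum (s1 ++ s2) = Some (val v) by rewrite osum_cat hs1 hs2.
have := osum_inj (catS _ _ sS tS) (catS _ _ s1S s2S) hst hs12.
case/perm_cat_split=> r1 [r2 [sr sub1 sub2]].
have := hs; rewrite (perm_osum sr) osum_cat => hr.
have [u1 [u2 [hu1 hu2]]] := oadd_someP hr.
have u1Q : u1 \in sums_of.
  by apply/sums_ofP; exists r1 => // y /(mem_subseq sub1)/s1S.
have u2Q : u2 \in sums_of.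
  by apply/sums_ofP; exists r2 => // y /(mem_subseq sub2)/s2S.
exists (exist _ u1 u1Q), (exist _ u2 u2Q); split.
- apply/subea_le; have [q hq] := perm_to_subseq sub1.
  by apply: (@ea_le_oadd _ _ (osum q)); rewrite -hu1 -osum_cat -(perm_osum hq).
- apply/subea_le; have [q hq] := perm_to_subseq sub2.
  by apply: (@ea_le_oadd _ _ (osum q)); rewrite -hu2 -osum_cat -(perm_osum hq).
- apply: omap_val_inj; rewrite val_oplus /=.
  by move: hr; rewrite hu1 hu2.
Qed.

End AtomFamily.

(** Atomic decompositions of x and of x' together form a family with sum 1. *)
Lemma riesz_cover x :
  exists2 Q : subEA E, riesz_decomposition (subea_type Q) & x \in subea_set Q.
Proof.
have [s as_ hs] := atomic_decomposition x.
have [t at_ ht] := atomic_decomposition (ocompl x).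
have atS : all atom (s ++ t) by rewrite all_cat as_.
have S1 : osum (s ++ t) = Some ea1.
  by rewrite osum_cat hs ht; apply: ocompl_oadd.
exists (sums_of_subEA atS S1); first exact: sums_of_riesz.
by apply/(sums_ofP atS S1); exists s => // y ys; rewrite mem_cat ys.
Qed.

End FiniteEffectAlgebra.

(** * Extension to blocks and the covering theorem *)

Lemma riesz_sub_block (E : finEffectAlgebraType) (Q : subEA E) :
  riesz_decomposition (subea_type Q) ->
  exists2 B : subEA E, block B & Q \subset B.
Proof.
(* Induction on the size of the complement of [Q], which shrinks whenever [Q] has a proper Riesz
   extension; excluded middle decides whether one exists. *)
have [n] := ubnP #|~: Q|; elim: n Q => // n IH Q lt_n rdpQ.
have [[C [rdpC QC]]|maxQ] := classic (exists C : subEA E,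
  riesz_decomposition (subea_type C) /\ Q \proper C).
  have [|B bB CB] := IH C _ rdpC.
    by rewrite -ltnS; apply: leq_trans lt_n; rewrite
       ltnS proper_card // properC.
  by exists B => //; apply: subset_trans CB; apply: proper_sub.
exists Q => //; split=> // C rdpC QC.
apply/eqP; rewrite eqEsubset QC andbT; apply/negPn/negP=> nCQ.
by case: maxQ; exists C; split=> //; rewrite properE QC.
Qed.

(** This makes a block a finite effect algebra, so that [riesz_lattice] applies to it. *)
HB.instance Definition _ (E : finEffectAlgebraType) (Q : subEA E) :=
  Finite.copy (subea_type Q) {x : E | x \in subea_set Q}.

Theorem corollary3p16 (E : finEffectAlgebraType) (hE : homogeneous E) :
  (forall x : E, exists2 B : subEA E, block B & x \in subea_set B) /\
  (forall B : subEA E, block B -> mv_effect_algebra (subea_type B)).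
Proof.
split=> [x|B [rdpB _]]; last by split=> //; apply: riesz_lattice.
have [Q rdpQ xQ] := riesz_cover hE x; have [B bB QB] := riesz_sub_block rdpQ.
by exists B => //; apply: (subsetP QB).
Qed.
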